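(* Let $\mu$ be a joint distribution of $(X,A,Y)$ with $X\in\mathcal{X}\subseteq\mathbb{R}^d$, $A\in\{0,1\}$, $Y\in\{0,1\}$. Let $g:\mathcal{X}\to\mathcal{Z}$ be a (measurable) feature transformation, $h:\mathcal{Z}\to\{0,1\}$ any (measurable) classifier, and $\widehat{Y}=h(g(X))$. Assume $$d_{\mathrm{JS}}(g_\sharp\mu_0,g_\sharp\mu_1)\le d_{\mathrm{JS}}(\mu_0(Y),\mu_1(Y))\quad\text{and}\quad H(g_\sharp\mu_0,g_\sharp\mu_1)\le H(\mu_0(Y),\mu_1(Y)).$$ Then the following three inequalities hold: 1. (Total variation) $\mathrm{Err}_{\mu_0}(h\circ g)+\mathrm{Err}_{\mu_1}(h\circ g)\ge d_{\mathrm{TV}}(\mu_0(Y),\mu_1(Y))-d_{\mathrm{TV}}(g_\sharp\mu_0,g_\sharp\mu_1)$. 2. (Jensen–Shannon) $\mathrm{Err}_{\mu_0}(h\circ g)+\mathrm{Err}_{\mu_1}(h\circ g)\ge \frac12\big(d_{\mathrm{JS}}(\mu_0(Y),\mu_1(Y))-d_{\mathrm{JS}}(g_\sharp\mu_0,g_\sharp\mu_1)\big)^2$. 3. (Hellinger) $\mathrm{Err}_{\mu_0}(h\circ g)+\mathrm{Err}_{\mu_1}(h\circ g)\ge \frac12\big(H(\mu_0(Y),\mu_1(Y))-H(g_\sharp\mu_0,g_\sharp\mu_1)\big)^2$.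
   Context: For $a\in\{0,1\}$, $\mu_a$ is the conditional distribution of $\mu$ given $A=a$ (it is assumed $\Pr(A=a)>0$); $\mu_a(Y)$ is the marginal law of $Y$ under $\mu_a$; $g_\sharp\mu_a$ is the law of $g(X)$ under $\mu_a$ (pushforward). $\mathrm{Err}_{\mu_a}(f)=\Pr_{\mu_a}(Y\neq f(X))$. For probability distributions $P,Q$ on the same space: $d_{\mathrm{TV}}(P,Q)=\sup_E|P(E)-Q(E)|$ over measurable $E$; $H(P,Q)=\sqrt{H^2(P,Q)}$ with $H^2(P,Q)=\frac12\int(\sqrt{dP}-\sqrt{dQ})^2$; $d_{\mathrm{JS}}(P,Q)=\sqrt{D_{\mathrm{JS}}(P,Q)}$ with $D_{\mathrm{JS}}(P,Q)=\frac12\big(D_{\mathrm{KL}}(P\|M)+D_{\mathrm{KL}}(Q\|M)\big)$, $M=\frac12(P+Q)$, and $D_{\mathrm{KL}}(P\|M)=\mathbb{E}_P[\log\frac{dP}{dM}]$. The logarithm has a fixed base $b\in\{2,e\}$, the same throughout (the claim is for either base). *)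

(* Defs.v *)
From HB Require Import structures.
From mathcomp Require Import all_boot all_order all_algebra.
From mathcomp Require Import all_classical all_reals all_analysis.
Set Implicit Arguments.
Unset Strict Implicit.
Unset Printing Implicit Defensive.
Import Order.TTheory GRing.Theory Num.Theory.
Import numFieldNormedType.Exports.

Local Open Scope classical_set_scope.
Local Open Scope ring_scope.
Local Open Scope charge_scope.

(* A subset D of a measurable space, D itself not required to be measurable,
   with the trace sigma-algebra (the preimages of measurable sets under the
   inclusion).  The library's measurable types are pointed, hence the witness
   x0 that D is nonempty. *)
Definition pointed_subset (T : Type) (D : set T) (x0 : D) : Type := D.

Section pointed_subset.
Context (T : choiceType) (D : set T) (x0 : D).
HB.instance Definition _ := Choice.copy (pointed_subset x0) D.
HB.instance Definition _ := isPointed.Build (pointed_subset x0) x0.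
End pointed_subset.

Section trace_space.
Context d (T : measurableType d) (D : set T) (x0 : D).

Definition incl (x : pointed_subset x0) : T := val (x : D).

Definition trace_space : Type := g_sigma_algebra_preimageType incl.

HB.instance Definition _ :=
  Measurable.copy trace_space (g_sigma_algebra_preimageType incl).
End trace_space.

Section divergences.
Context d (T : measurableType d) (R : realType).
Implicit Types P Q : probability T R.

Definition dTV P Q : R :=
  sup [set `|fine (P E) - fine (Q E)| | E in @measurable _ T].

Definition mixture P Q : set T -> \bar R :=
  mscale (2^-1)%:nng (measure_add P Q).

HB.instance Definition _ P Q := Measure.on (mixture P Q).

Lemma mixture_setT P Q : mixture P Q [set: T] = 1%E.
Proof.
have -> : mixture P Q [set: T] = ((2^-1)%:E * (P [set: T] + Q [set: T]))%E.
  by rewrite -measure_addE.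
by rewrite !probability_setT -EFinD -EFinM mulVf.
Qed.

HB.instance Definition _ P Q :=
  Measure_isProbability.Build _ _ _ (mixture P Q) (mixture_setT P Q).

(* dP/dQ; meaningful only when P is dominated by Q. *)
Definition density P Q (x : T) : R :=
  fine (('d (charge_of_finite_measure P) '/d Q) x).

(* The integral of (sqrt dP - sqrt dQ)^2 does not depend on the measure that
   dominates P and Q with respect to which the densities are taken; the
   mixture (P + Q) / 2 dominates both. *)
Definition Hellinger2 P Q : R :=
  let M := mixture P Q in
  2^-1 * \int[M]_x (Num.sqrt (density P M x) - Num.sqrt (density Q M x)) ^+ 2.

Definition Hellinger P Q : R := Num.sqrt (Hellinger2 P Q).

Definition logb (b x : R) : R := ln x / ln b.

(* On the P-negligible set where dP/dQ = 0 the value of logb is irrelevant. *)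
Definition KL (b : R) P Q : \bar R :=
  if `[< P `<< Q >] then (\int[P]_x (logb b (density P Q x))%:E)%E else +oo%E.

Definition JS (b : R) P Q : \bar R :=
  let M := mixture P Q in ((2^-1)%:E * (KL b P M + KL b Q M))%E.

(* JS is always finite (at most log 2), so fine loses nothing. *)
Definition dJS (b : R) P Q : R := Num.sqrt (fine (JS b P Q)).

End divergences.

(* A joint distribution of (X, A, Y) is a probability on S * bool * bool, where
   S is the space of X and true / false stand for 1 / 0. *)
Section joint_distribution.
Context d (S : measurableType d) (R : realType).

Definition coordX (w : S * bool * bool) : S := w.1.1.
Definition coordA (w : S * bool * bool) : bool := w.1.2.
Definition coordY (w : S * bool * bool) : bool := w.2.

Lemma measurable_coordX : measurable_fun [set: S * bool * bool] coordX.
Proof. exact: measurableT_comp measurable_fst measurable_fst. Qed.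

Lemma measurable_coordA : measurable_fun [set: S * bool * bool] coordA.
Proof. exact: measurableT_comp measurable_snd measurable_fst. Qed.

Lemma measurable_coordY : measurable_fun [set: S * bool * bool] coordY.
Proof. exact: measurable_snd. Qed.

HB.instance Definition _ :=
  isMeasurableFun.Build _ _ _ _ coordY measurable_coordY.

Lemma measurable_groupA (a : bool) : measurable (coordA @^-1` [set a]).
Proof. by rewrite -[X in measurable X]setTI; exact: measurable_coordA. Qed.

Variable mu : probability (S * bool * bool)%type R.

(* The conditional distribution given A = a.  If that event has probability 0,
   mnormalize returns its default argument mu. *)
Definition cond (a : bool) : probability (S * bool * bool)%type R :=
  mnormalize (mrestr mu (measurable_groupA a)) mu.

Definition lawY (a : bool) : probability bool R :=
  distribution (cond a) coordY.

Definition Err (a : bool) (f : S -> bool) : R :=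
  fine (cond a [set w | coordY w != f (coordX w)]).

Context d' (Z : measurableType d') (g : {mfun S >-> Z}).

Definition feature (w : S * bool * bool) : Z := g (coordX w).

Lemma measurable_feature : measurable_fun [set: S * bool * bool] feature.
Proof. exact: measurableT_comp measurable_coordX. Qed.

HB.instance Definition _ :=
  isMeasurableFun.Build _ _ _ _ feature measurable_feature.

Definition law_feature (a : bool) : probability Z R :=
  distribution (cond a) feature.

End joint_distribution.

(* Main.v *)
Require Import Defs.
From mathcomp Require Import all_boot all_order all_algebra.
From mathcomp Require Import all_classical all_reals all_analysis.
From mathcomp Require Import measurable_realfun ring lra.
Import Order.TTheory GRing.Theory Num.Theory.
Import numFieldNormedType.Exports.

Set Implicit Arguments.
Unset Strict Implicit.
Unset Printing Implicit Defensive.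

Local Open Scope classical_set_scope.
Local Open Scope ring_scope.

(* Each of the three distances d satisfies, with Yhat = h(g(X)),
     d(Y_0, Y_1) <= d(Y_0, Yhat_0) + d(Yhat_0, Yhat_1) + d(Yhat_1, Y_1),
   where the subscript denotes conditioning on A.  The middle term is at most
   the distance of the feature laws by data processing, and for two laws on
   {0, 1} total variation, squared Hellinger distance and Jensen-Shannon
   divergence are all at most the difference of the probabilities of 1, so the
   outer terms are bounded by Err_a, resp. by its square root; finally
   (sqrt e0 + sqrt e1)^2 <= 2 (e0 + e1), and the hypotheses allow squaring.

   The triangle inequality for the square root of the Jensen-Shannon
   divergence reduces, by Minkowski, to the one for sqrt (jsd x y), where
   jsd x y = x ln (x/m) + y ln (y/m) with m = (x+y)/2.  For p < r < q the
   function r |-> sqrt (jsd p r) + sqrt (jsd q r) is first nondecreasing and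
   then nonincreasing, hence at least its value at the ends: the squares of the
   two terms of its derivative, multiplied by r, are monotone in r in opposite
   directions, which amounts to
     a ln a + b ln b + ln a ln b <= 0  for a + b = 2. *)

(** * The function x ln x *)

Lemma ge0_is_derive_le (R : realType) (f df : R -> R) (a b : R) : a <= b ->
  (forall x, x \in `]a, b[ -> is_derive x 1 f (df x)) ->
  (forall x, x \in `]a, b[ -> 0 <= df x) ->
  {within `[a, b], continuous f} -> f a <= f b.
Proof.
rewrite le_eqVlt => /predU1P[->//|ab] fdf df0 cf.
have [c cab fc] := MVT ab fdf cf.
by rewrite -subr_ge0 fc mulr_ge0 ?df0// subr_ge0 ltW.
Qed.

Lemma is_derive_within_continuous (R : realType) (f df : R -> R) (a b : R) :
  (forall x, x \in `[a, b] -> is_derive x 1 f (df x)) ->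
  {within `[a, b], continuous f}.
Proof.
move=> fdf; apply: derivable_within_continuous => x /fdf fx; exact: ex_derive.
Qed.

Definition xlnx (R : realType) (x : R) : R := x * ln x.

Lemma ln_le_subr1 (R : realType) (x : R) : 0 < x -> ln x <= x - 1.
Proof.
by move=> x0; have := @le_ln1Dx R (x - 1); rewrite [1 + _]addrC subrK; apply; lra.
Qed.

Lemma sqr_exists (R : realType) (x : R) : 0 < x -> exists2 s, 0 < s & x = s ^+ 2.
Proof.
by move=> x0; exists (Num.sqrt x); rewrite ?sqrtr_gt0 ?sqr_sqrtr ?ltW.
Qed.

(** Strictness comes from a square root: with x = s^2, ln x = 2 ln s <= 2 (s - 1) = x - 1 - (s -
    1)^2. *)
Lemma ln_lt_subr1 (R : realType) (x : R) : 0 < x -> x != 1 -> ln x < x - 1.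
Proof.
move=> /sqr_exists[s s0 ->] s1; rewrite lnXn// mulr2n.
have : 0 < (s - 1) ^+ 2.
  rewrite exprn_even_gt0//= subr_eq0; apply: contra s1 => /eqP ->.
  by rewrite expr1n.
by have := ln_le_subr1 s0; nra.
Qed.

(** The left side is the tangent at c of the convex function x ln x; the bound is ln (c/x) <= c/x -
    1 multiplied by x. *)
Lemma xlnx_tangent (R : realType) (c x : R) : 0 < c -> 0 <= x ->
  x * ln c + x - c <= xlnx x.
Proof.
move=> c0; rewrite le_eqVlt => /predU1P[<-|x0]; first by rewrite /xlnx; lra.
have := @ln_le_subr1 _ (c / x) (divr_gt0 c0 x0).
rewrite ln_div// -(ler_pM2l x0) mulrBr mulrBr mulrCA divff ?gt_eqF//.
by rewrite /xlnx; lra.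
Qed.

Lemma xlnx_tangent_lt (R : realType) (c x : R) : 0 < c -> 0 <= x -> x != c ->
  x * ln c + x - c < xlnx x.
Proof.
move=> c0; rewrite le_eqVlt => /predU1P[<-|x0] xc; first by rewrite /xlnx; lra.
have : ln (c / x) < c / x - 1.
  apply: ln_lt_subr1; first exact: divr_gt0.
  by apply: contra xc => /eqP/divr1_eq ->.
rewrite ln_div// -(ltr_pM2l x0) mulrBr mulrBr mulrCA divff ?gt_eqF//.
by rewrite /xlnx; lra.
Qed.

Lemma continuous_xlnx (R : realType) : continuous (@xlnx R).
Proof.
move=> x; have [x0|x0|->] := ltgtP x 0.
- rewrite /continuous_at {2}/xlnx ln0 ?(ltW x0)// mulr0.
  apply: cvg_near_cst; near=> y; rewrite /xlnx ln0 ?mulr0//; apply: ltW.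
  by near: y; exact: lt_nbhsl.
- by apply: continuousM; [exact: cvg_id|exact: continuous_ln].
- rewrite /continuous_at {2}/xlnx mul0r.
  (* Continuity at 0 by squeezing: with y = s^2, the bound amounts to - s ln s <= 1, that is, ln
     (1/s) <= 1/s. For y <= 0 the convention ln y = 0 applies. *)
  have bnd (y : R) : y < 1 -> `|xlnx y| <= 2 * Num.sqrt y.
    move=> y1; have [y0|y0] := leP y 0.
      by rewrite /xlnx ln0// mulr0 normr0 mulr_ge0 ?sqrtr_ge0.
    rewrite ler0_norm /xlnx; last by rewrite pmulr_rle0// ln_le0// ltW.
    move: y0 => /sqr_exists[s s0 ->]; rewrite lnXn// sqrtr_sqr gtr0_norm//.
    have : - ln s <= s^-1.
      rewrite -lnV ?posrE//; have := @ln_le_subr1 R s^-1.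
      by rewrite invr_gt0 => /(_ s0); lra.
    rewrite -(ler_pM2l s0) divff ?gt_eqF// -(ler_pM2l s0) mulr2n; nra.
  apply/cvgr0Pnorm_le => e e0.
  have h : 2 * Num.sqrt y @[y --> (0:R)] --> 2 * Num.sqrt (0:R).
    by apply: cvgMr; exact: sqrt_continuous.
  rewrite sqrtr0 mulr0 in h.
  move/cvgr0Pnorm_le : h => /(_ _ e0) h.
  near=> y; apply: (@le_trans _ _ (2 * Num.sqrt y)).
    by apply: bnd; near: y; apply: lt_nbhsl; exact: ltr01.
  by apply: le_trans (ler_norm _) _; near: y.
Unshelve. all: by end_near. Qed.

Lemma is_derive_xlnx (R : realType) (x : R) : 0 < x ->
  is_derive x 1 (@xlnx R) (ln x + 1).
Proof.
move=> x0; have dl := is_derive1_ln x0.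
apply: is_derive_eq.
by rewrite /= scaler1 -[_ *: _]/(_ * _) mulfV ?gt_eqF// addrC.
Qed.

(** The negated left side [f] vanishes at 0, and its derivative is v / (1 - v^2) times (1+v) ln
    (1+v) + (1-v) ln (1-v). The latter is nonnegative: the tangents of x ln x at 1, taken at 1 + v
    and 1 - v, add up to 0. *)
Lemma two_point_log_le0 (R : realType) (u : R) : 0 <= u < 1 ->
  xlnx (1 + u) + xlnx (1 - u) + ln (1 + u) * ln (1 - u) <= 0.
Proof.
move=> /andP[u0 u1].
pose f (v : R) := - (xlnx (1 + v) + xlnx (1 - v) + ln (1 + v) * ln (1 - v)).
pose df (v : R) := v / (1 - v ^+ 2) * (xlnx (1 + v) + xlnx (1 - v)).
have fdf v : v \in `[0, u] -> is_derive v 1 f (df v).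
  rewrite in_itv/= => /andP[v0 vu].
  have p1 : 0 < 1 + v by lra.
  have p2 : 0 < 1 - v by lra.
  have d1 : is_derive v 1 (fun v => 1 + v : R) 1.
    by apply: is_derive_eq; rewrite add0r mulr1.
  have d2 : is_derive v 1 (fun v => 1 - v : R) (-1).
    by apply: is_derive_eq; rewrite add0r mul1r.
  have l1 := @is_derive1_comp R (@ln R) (fun v => 1 + v) _ _ _ (is_derive1_ln p1) d1.
  have l2 := @is_derive1_comp R (@ln R) (fun v => 1 - v) _ _ _ (is_derive1_ln p2) d2.
  have x1 := @is_derive1_comp R (@xlnx R) (fun v => 1 + v) _ _ _ (is_derive_xlnx p1) d1.
  have x2 := @is_derive1_comp R (@xlnx R) (fun v => 1 - v) _ _ _ (is_derive_xlnx p2) d2.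
  have := is_deriveN (is_deriveD (is_deriveD x1 x2) (is_deriveM l1 l2)).
  move=> H; apply: (is_derive_eq H).
  rewrite /df /xlnx/= -![_ *: _]/(_ * _).
  by field; rewrite -?(subr_sqr_1) ?gt_eqF//; nra.
have fdf' v : v \in `]0, u[ -> is_derive v 1 f (df v).
  by move=> /subset_itv_oo_cc; exact: fdf.
have df0 v : v \in `]0, u[ -> 0 <= df v.
  rewrite in_itv/= => /andP[v0 vu].
  apply: mulr_ge0; first by apply: divr_ge0; nra.
  have := @xlnx_tangent R 1 (1 + v) ltr01; have := @xlnx_tangent R 1 (1 - v) ltr01.
  by rewrite ln1 !mulr0 => /(_ ltac:(lra)) ? /(_ ltac:(lra)) ?; lra.
have := ge0_is_derive_le u0 fdf' df0 (is_derive_within_continuous fdf).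
by rewrite /f /xlnx !subr0 !addr0 ln1; lra.
Qed.

(** * The triangle inequality for the Jensen-Shannon distance *)

(* With m = (x + y) / 2 this is x ln (x/m) + y ln (y/m), the contribution of an
   atom of masses x and y to twice the Jensen-Shannon divergence in base e; this
   form also covers x = 0. *)
Definition jsd (R : realType) (x y : R) : R :=
  xlnx x + xlnx y - 2 * xlnx ((x + y) / 2).

(** The derivative of [jsd x] at y, see [is_derive_jsd]. *)
Definition lnmid (R : realType) (x y : R) : R := ln y - ln ((x + y) / 2).

Lemma jsdC (R : realType) (x y : R) : jsd x y = jsd y x.
Proof. by rewrite /jsd [x + y]addrC; ring. Qed.

Lemma jsdxx (R : realType) (x : R) : jsd x x = 0.
Proof. by rewrite /jsd (_ : (x + x) / 2 = x); [ring|field]. Qed.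

Lemma jsdE (R : realType) (x y : R) :
  jsd x y = x * lnmid y x + y * lnmid x y.
Proof. by rewrite /jsd /lnmid /xlnx [y + x]addrC; field. Qed.

(** Strict convexity of x ln x: its tangents at the midpoint m, taken at x and at y, add up to 2 m
    ln m. *)
Lemma jsd_gt0 (R : realType) (x y : R) :
  0 <= x -> 0 <= y -> x != y -> 0 < jsd x y.
Proof.
move=> x0 y0 xy; have m0 : 0 < (x + y) / 2.
  have [xy'|xy'|xy'] := ltgtP x y; [lra|lra|by rewrite xy' eqxx in xy].
have := xlnx_tangent m0 y0.
have : x * ln ((x + y) / 2) + x - (x + y) / 2 < xlnx x.
  by apply: xlnx_tangent_lt => //; apply: contra xy => /eqP xm; apply/eqP; lra.
by rewrite /jsd (_ : xlnx ((x + y) / 2) = (x + y) / 2 * ln ((x + y) / 2))//; lra.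
Qed.

Lemma jsd_ge0 (R : realType) (x y : R) : 0 <= x -> 0 <= y -> 0 <= jsd x y.
Proof.
move=> x0 y0; have [->|xy] := eqVneq x y; first by rewrite jsdxx.
exact/ltW/jsd_gt0.
Qed.

Lemma continuous_jsd (R : realType) (x : R) : continuous (jsd x).
Proof.
move=> y; apply: cvgB.
  by apply: cvgD; [exact: cvg_cst|exact: continuous_xlnx].
apply: cvgMr.
apply: (@continuous_comp _ _ _ (fun y => (x + y) / 2) (@xlnx R)).
  by apply: cvgMl; apply: cvgD; [exact: cvg_cst|exact: cvg_id].
exact: continuous_xlnx.
Qed.

Lemma is_derive_mid (R : realType) (x y : R) :
  is_derive y 1 (fun y => (x + y) / 2 : R) (2^-1).
Proof.
have H : is_derive y 1 ((cst x + id) * cst (2^-1) : R -> R) (2^-1).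
  by apply: is_derive_eq; rewrite /= scaler0 !add0r -[_ *: _]/(_ * _) mulr1.
exact: H.
Qed.

Lemma is_derive_jsd (R : realType) (x y : R) : 0 <= x -> 0 < y ->
  is_derive y 1 (jsd x) (lnmid x y).
Proof.
move=> x0 y0; have m0 : 0 < (x + y) / 2 by lra.
have dm := @is_derive1_comp R (@xlnx R) (fun y => (x + y) / 2) _ _ _
  (is_derive_xlnx m0) (is_derive_mid x y).
have := is_deriveB (is_deriveD (is_derive_cst (xlnx x) y 1)
  (is_derive_xlnx y0)) (is_deriveZ 2 dm).
move=> H; apply: (is_derive_eq H).
by rewrite /lnmid -![_ *: _]/(_ * _); field.
Qed.

Lemma is_derive_lnmid (R : realType) (x y : R) : 0 <= x -> 0 < y ->
  is_derive y 1 (lnmid x) (x / (y * (x + y))).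
Proof.
move=> x0 y0; have m0 : 0 < (x + y) / 2 by lra.
have dm := @is_derive1_comp R (@ln R) (fun y => (x + y) / 2) _ _ _
  (is_derive1_ln m0) (is_derive_mid x y).
have := is_deriveB (is_derive1_ln y0) dm.
move=> H; apply: (is_derive_eq H).
by field; rewrite !gt_eqF//; lra.
Qed.

Lemma lnmid_ge0 (R : realType) (x y : R) : 0 <= x -> 0 < y -> x <= y ->
  0 <= lnmid x y.
Proof.
by move=> x0 y0 xy; rewrite subr_ge0 ler_ln ?posrE; lra.
Qed.

Lemma lnmid_le0 (R : realType) (x y : R) : 0 <= x -> 0 < y -> y <= x ->
  lnmid x y <= 0.
Proof.
by move=> x0 y0 xy; rewrite subr_le0 ler_ln ?posrE; lra.
Qed.

(** Both sides are homogeneous of degree 1. Dividing by the mean m turns x <= y into 1 - u and 1 +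
    u, and the claim becomes [two_point_log_le0]. *)
Lemma jsd_le_mul_lnmid (R : realType) (x y : R) : 0 < x -> 0 < y ->
  jsd x y <= - ((x + y) / 2 * lnmid y x * lnmid x y).
Proof.
wlog xy : x y / x <= y => [H|] x0 y0.
  have [xy|/ltW yx] := leP x y; first exact: H.
  by have := H _ _ yx y0 x0; rewrite jsdC [y + x]addrC mulrAC.
pose m := (x + y) / 2; have m0 : 0 < m by rewrite /m; lra.
pose u := (y - m) / m.
have u0 : 0 <= u by apply: divr_ge0; rewrite /m; lra.
have u1 : u < 1 by rewrite ltr_pdivrMr// /m; lra.
have yu : 1 + u = y / m by rewrite /u; field; rewrite gt_eqF.
have xu : 1 - u = x / m by rewrite /u /m; field; lra.
have uI : 0 <= u < 1 by rewrite u0 u1.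
have := two_point_log_le0 uI.
rewrite /xlnx yu xu (ln_div y0 m0) (ln_div x0 m0).
rewrite jsdE /lnmid [y + x]addrC -/m.
set X := ln x - ln m; set Y := ln y - ln m => H.
rewrite -subr_le0 (_ : _ - _ = m * (y / m * Y + x / m * X + Y * X)).
  by rewrite pmulr_rle0.
by field; rewrite gt_eqF.
Qed.

(** The derivative of sqrt (jsd x y) in y is lnmid x y / (2 sqrt (jsd x y)); this is 4 y times its
    square. The factor y is what makes it monotone on either side of x. *)
Definition jsd_slope2 (R : realType) (x y : R) : R :=
  y * lnmid x y ^+ 2 / jsd x y.

Definition jsd_slope2' (R : realType) (x y : R) : R :=
  lnmid x y * (lnmid x y * jsd x y + 2 * x / (x + y) * jsd x y
    - y * lnmid x y ^+ 2) / jsd x y ^+ 2.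

Lemma is_derive_jsd_slope2 (R : realType) (x y : R) :
  0 <= x -> 0 < y -> y != x ->
  is_derive y 1 (jsd_slope2 x) (jsd_slope2' x y).
Proof.
move=> x0 y0 yx; have L0 : 0 < jsd x y by rewrite jsd_gt0 ?(ltW y0)// eq_sym.
have dl := is_derive_lnmid x0 y0.
have dL := is_derive_jsd x0 y0.
have := is_deriveM (is_deriveM (is_derive_id y 1) (is_deriveM dl dl))
  (is_deriveV (lt0r_neq0 L0) dL).
move=> H; apply: (is_derive_eq H).
rewrite /jsd_slope2' -![_ *: _]/(_ * _) /= -![(_ * _) y]/(_ * _).
by field; rewrite !gt_eqF//=; lra.
Qed.

(** By [jsdE], jsd x y - y lnmid x y = x lnmid y x, so 2 x / (x + y) factors out and the cofactor is
    nonpositive by [jsd_le_mul_lnmid]. For x = 0 the expression vanishes. *)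
Lemma jsd_slope2_num_le0 (R : realType) (x y : R) : 0 <= x -> 0 < y ->
  lnmid x y * jsd x y + 2 * x / (x + y) * jsd x y - y * lnmid x y ^+ 2 <= 0.
Proof.
rewrite le_eqVlt => /predU1P[<-|x0] y0.
  by rewrite jsdE mulr0 !mul0r addr0 add0r expr2 mulrCA subrr.
rewrite (_ : _ - _ = 2 * x / (x + y) *
    ((x + y) / 2 * lnmid y x * lnmid x y + jsd x y)); last first.
  by rewrite jsdE; field; lra.
apply: mulr_ge0_le0; first by apply: divr_ge0; lra.
by have := jsd_le_mul_lnmid x0 y0; lra.
Qed.

(** The derivative is [lnmid x] times a nonpositive factor, and [lnmid x] changes sign at x: hence
    decrease to the right of x and, in [jsd_slope2_ndecr], increase to its left. *)
Lemma jsd_slope2_nincr (R : realType) (x y z : R) : 0 <= x -> x < y -> y <= z ->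
  jsd_slope2 x z <= jsd_slope2 x y.
Proof.
move=> x0 xy yz; rewrite -lerN2.
have D v : v \in `[y, z] ->
    is_derive v 1 (\- (jsd_slope2 x)) (- jsd_slope2' x v).
  rewrite in_itv/= => /andP[yv vz].
  have v0 : 0 < v by lra.
  have vx : v != x by rewrite gt_eqF//; lra.
  exact: is_deriveN (is_derive_jsd_slope2 x0 v0 vx).
have D' v : v \in `]y, z[ ->
    is_derive v 1 (\- (jsd_slope2 x)) (- jsd_slope2' x v).
  by move=> /subset_itv_oo_cc; exact: D.
have D0 v : v \in `]y, z[ -> 0 <= - jsd_slope2' x v.
  rewrite in_itv/= => /andP[yv vz].
  have v0 : 0 < v by lra.
  rewrite oppr_ge0; apply: mulr_le0_ge0; last by rewrite invr_ge0 sqr_ge0.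
  apply: mulr_ge0_le0; first by apply: lnmid_ge0; lra.
  exact: jsd_slope2_num_le0.
exact: ge0_is_derive_le yz D' D0 (is_derive_within_continuous D).
Qed.

Lemma jsd_slope2_ndecr (R : realType) (x y z : R) : 0 < y -> y <= z -> z < x ->
  jsd_slope2 x y <= jsd_slope2 x z.
Proof.
move=> y0 yz zx; have x0 : 0 <= x by lra.
have D v : v \in `[y, z] -> is_derive v 1 (jsd_slope2 x) (jsd_slope2' x v).
  rewrite in_itv/= => /andP[yv vz].
  have v0 : 0 < v by lra.
  have vx : v != x by rewrite lt_eqF//; lra.
  exact: is_derive_jsd_slope2 x0 v0 vx.
have D' v : v \in `]y, z[ -> is_derive v 1 (jsd_slope2 x) (jsd_slope2' x v).
  by move=> /subset_itv_oo_cc; exact: D.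
have D0 v : v \in `]y, z[ -> 0 <= jsd_slope2' x v.
  rewrite in_itv/= => /andP[yv vz].
  have v0 : 0 < v by lra.
  apply: mulr_ge0; last by rewrite invr_ge0 sqr_ge0.
  apply: mulr_le0; first by apply: lnmid_le0; lra.
  exact: jsd_slope2_num_le0.
exact: ge0_is_derive_le yz D' D0 (is_derive_within_continuous D).
Qed.

Lemma jsd_ndecr (R : realType) (x y z : R) : 0 <= x -> x <= y -> y <= z ->
  jsd x y <= jsd x z.
Proof.
move=> x0 xy yz.
have D v : v \in `]y, z[ -> is_derive v 1 (jsd x) (lnmid x v).
  by rewrite in_itv/= => /andP[yv vz]; apply: is_derive_jsd => //; lra.
have D0 v : v \in `]y, z[ -> 0 <= lnmid x v.
  by rewrite in_itv/= => /andP[yv vz]; apply: lnmid_ge0 => //; lra.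
apply: ge0_is_derive_le yz D D0 _.
exact/continuous_subspaceT/continuous_jsd.
Qed.

Lemma jsd_nincr (R : realType) (x y z : R) : 0 <= y -> y <= z -> z <= x ->
  jsd x z <= jsd x y.
Proof.
move=> y0 yz zx; rewrite -lerN2.
have D v : v \in `]y, z[ -> is_derive v 1 (\- (jsd x)) (- lnmid x v).
  rewrite in_itv/= => /andP[yv vz].
  by apply: is_deriveN; apply: is_derive_jsd => //; lra.
have D0 v : v \in `]y, z[ -> 0 <= - lnmid x v.
  by rewrite in_itv/= oppr_ge0 => /andP[yv vz]; apply: lnmid_le0 => //; lra.
apply: ge0_is_derive_le yz D D0 _; apply: continuous_subspaceT => v.
by apply: cvgN; exact: continuous_jsd.
Qed.

Definition sqrt_jsd_detour (R : realType) (p q r : R) : R :=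
  Num.sqrt (jsd p r) + Num.sqrt (jsd q r).

Definition sqrt_jsd_detour' (R : realType) (p q r : R) : R :=
  lnmid p r / (2 * Num.sqrt (jsd p r)) + lnmid q r / (2 * Num.sqrt (jsd q r)).

Lemma is_derive_sqrt_jsd (R : realType) (p r : R) :
  0 <= p -> 0 < r -> r != p ->
  is_derive r 1 (fun r => Num.sqrt (jsd p r))
    (lnmid p r / (2 * Num.sqrt (jsd p r))).
Proof.
move=> p0 r0 rp; have L0 : 0 < jsd p r by rewrite jsd_gt0 ?(ltW r0)// eq_sym.
have := @is_derive1_comp R (@Num.sqrt R) (jsd p) _ _ _
  (is_derive1_sqrt L0) (is_derive_jsd p0 r0).
by move=> H; apply: (is_derive_eq H); rewrite mulrC.
Qed.

Lemma is_derive_sqrt_jsd_detour (R : realType) (p q r : R) :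
  0 <= p -> p < r -> r < q ->
  is_derive r 1 (sqrt_jsd_detour p q) (sqrt_jsd_detour' p q r).
Proof.
move=> p0 pr rq; apply: is_deriveD; apply: is_derive_sqrt_jsd; lra.
Qed.

Lemma continuous_sqrt_jsd_detour (R : realType) (p q : R) :
  continuous (sqrt_jsd_detour p q).
Proof.
move=> r; apply: cvgD.
  apply: (@continuous_comp _ _ _ (jsd p) (@Num.sqrt R)).
    exact: continuous_jsd.
  exact: sqrt_continuous.
apply: (@continuous_comp _ _ _ (jsd q) (@Num.sqrt R)).
  exact: continuous_jsd.
exact: sqrt_continuous.
Qed.

(** Between p and q the term from p is nonnegative and the one from q nonpositive, so the sign of
    their sum is found by comparing squares; multiplied by 4 r, these are the two values of
    [jsd_slope2]. *)
Lemma sqrt_jsd_detour_ge0 (R : realType) (p q r : R) : 0 <= p -> p < r -> r < q ->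
  jsd_slope2 q r <= jsd_slope2 p r -> 0 <= sqrt_jsd_detour' p q r.
Proof.
move=> p0 pr rq; have r0 : 0 < r by lra.
have Lp : 0 < jsd p r by rewrite jsd_gt0 ?lt_eqF//; lra.
have Lq : 0 < jsd q r by rewrite jsd_gt0 ?gt_eqF//; lra.
have a0 : 0 <= lnmid p r by apply: lnmid_ge0; lra.
have b0 : lnmid q r <= 0 by apply: lnmid_le0; lra.
rewrite /jsd_slope2 /sqrt_jsd_detour'.
have [A A0 ->] := sqr_exists Lp; have [B B0 ->] := sqr_exists Lq.
move: (lnmid p r) (lnmid q r) a0 b0 => a b a0 b0.
rewrite !sqrtr_sqr !gtr0_norm// -![r * _ / _]mulrA ler_pM2l// -!expr_div_n => H.
have {}H : - (b / B) <= a / A.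
  rewrite -ler_sqr ?nnegrE ?sqrrN//; last by rewrite divr_ge0// ltW.
  by rewrite oppr_ge0 mulr_le0_ge0// invr_ge0 ltW.
by rewrite !invfM; lra.
Qed.

Lemma sqrt_jsd_detour_le0 (R : realType) (p q r : R) : 0 <= p -> p < r -> r < q ->
  jsd_slope2 p r <= jsd_slope2 q r -> sqrt_jsd_detour' p q r <= 0.
Proof.
move=> p0 pr rq; have r0 : 0 < r by lra.
have Lp : 0 < jsd p r by rewrite jsd_gt0 ?lt_eqF//; lra.
have Lq : 0 < jsd q r by rewrite jsd_gt0 ?gt_eqF//; lra.
have a0 : 0 <= lnmid p r by apply: lnmid_ge0; lra.
have b0 : lnmid q r <= 0 by apply: lnmid_le0; lra.
rewrite /jsd_slope2 /sqrt_jsd_detour'.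
have [A A0 ->] := sqr_exists Lp; have [B B0 ->] := sqr_exists Lq.
move: (lnmid p r) (lnmid q r) a0 b0 => a b a0 b0.
rewrite !sqrtr_sqr !gtr0_norm// -![r * _ / _]mulrA ler_pM2l// -!expr_div_n => H.
have {}H : a / A <= - (b / B).
  rewrite -ler_sqr ?nnegrE ?sqrrN//; first by rewrite divr_ge0// ltW.
  by rewrite oppr_ge0 mulr_le0_ge0// invr_ge0 ltW.
by rewrite !invfM; lra.
Qed.

(** If the slope from p dominates at r, it still does at every s in (p, r), since moving left raises
    [jsd_slope2 p] and lowers [jsd_slope2 q]; the detour is then nondecreasing on [p, r], and at p
    it is the direct distance. Otherwise the same argument runs from r to q. *)
Lemma sqrt_jsd_triangle_between (R : realType) (p q r : R) :
  0 <= p -> p < r -> r < q ->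
  Num.sqrt (jsd p q) <= sqrt_jsd_detour p q r.
Proof.
move=> p0 pr rq.
have cf := @continuous_sqrt_jsd_detour R p q.
have [H|/ltW H] := leP (jsd_slope2 q r) (jsd_slope2 p r).
- have -> : Num.sqrt (jsd p q) = sqrt_jsd_detour p q p.
    by rewrite /sqrt_jsd_detour jsdxx sqrtr0 add0r jsdC.
  have D s : s \in `]p, r[ ->
      is_derive s 1 (sqrt_jsd_detour p q) (sqrt_jsd_detour' p q s).
    rewrite in_itv/= => /andP[ps sr].
    by apply: is_derive_sqrt_jsd_detour => //; lra.
  have D0 s : s \in `]p, r[ -> 0 <= sqrt_jsd_detour' p q s.
    rewrite in_itv/= => /andP[ps sr].
    apply: sqrt_jsd_detour_ge0 => //; first lra.
    apply: (le_trans (@jsd_slope2_ndecr R q s r _ _ _)); [lra..|].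
    by apply: (le_trans H); apply: jsd_slope2_nincr => //; lra.
  exact: ge0_is_derive_le (ltW pr) D D0 (continuous_subspaceT cf).
- have -> : Num.sqrt (jsd p q) = sqrt_jsd_detour p q q.
    by rewrite /sqrt_jsd_detour jsdxx sqrtr0 addr0.
  rewrite -lerN2.
  have D s : s \in `]r, q[ ->
      is_derive s 1 (\- sqrt_jsd_detour p q) (- sqrt_jsd_detour' p q s).
    rewrite in_itv/= => /andP[rs sq].
    by apply: is_deriveN; apply: is_derive_sqrt_jsd_detour => //; lra.
  have D0 s : s \in `]r, q[ -> 0 <= - sqrt_jsd_detour' p q s.
    rewrite in_itv/= oppr_ge0 => /andP[rs sq].
    apply: sqrt_jsd_detour_le0 => //; first lra.
    apply: (le_trans (@jsd_slope2_nincr R p r s _ _ _)); [lra..|].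
    by apply: (le_trans H); apply: jsd_slope2_ndecr => //; lra.
  apply: (ge0_is_derive_le (ltW rq) D D0); apply: continuous_subspaceT => s.
  by apply: cvgN; exact: cf.
Qed.

(** When r lies outside the interval from p to q, the leg from r to the farther endpoint alone
    suffices, by monotonicity of [jsd]. *)
Lemma sqrt_jsd_triangle (R : realType) (p q r : R) :
  0 <= p -> 0 <= q -> 0 <= r ->
  Num.sqrt (jsd p q) <= Num.sqrt (jsd p r) + Num.sqrt (jsd r q).
Proof.
wlog pq : p q / p <= q => [H|] p0 q0 r0.
  have [pq|/ltW qp] := leP p q; first exact: H.
  have := H _ _ qp q0 p0 r0.
  by rewrite jsdC addrC [jsd r p]jsdC [jsd q r]jsdC.
have [rp|pr] := leP r p.
  rewrite -[leLHS]add0r lerD ?sqrtr_ge0// ler_wsqrtr// jsdC [jsd r q]jsdC.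
  exact: jsd_nincr.
have [rq|qr] := ltP r q.
  by rewrite [jsd r q]jsdC; exact: sqrt_jsd_triangle_between.
rewrite -[leLHS]addr0 lerD ?sqrtr_ge0// ler_wsqrtr//.
exact: jsd_ndecr.
Qed.

(** For p <= q with mean m, p ln p is at most p ln m, and q ln q exceeds q ln m by at most ln 2 (q -
    p). Equality at p = 0 shows where the constant ln 2 comes from. *)
Lemma jsd_le_dist (R : realType) (p q : R) : 0 <= p -> 0 <= q ->
  jsd p q <= ln 2 * `|p - q|.
Proof.
wlog pq : p q / p <= q => [H|] p0 q0.
  have [pq|/ltW qp] := leP p q; first exact: H.
  by have := H _ _ qp q0 p0; rewrite jsdC distrC.
rewrite ler0_norm; last by lra.
have [q_le0|q_gt0] := leP q 0.
  have -> : p = q by lra.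
  by rewrite jsdxx subrr oppr0 mulr0.
pose m := (p + q) / 2; have m0 : 0 < m by rewrite /m; lra.
have lp : p * ln p <= p * ln m.
  move: p0; rewrite le_eqVlt => /predU1P[<-|p0]; first by rewrite !mul0r.
  by rewrite ler_pM2l// ler_ln ?posrE// /m; lra.
(* Convexity of x ln x at q, a convex combination of m and 2m *)
have lq : q * ln q <= q * ln m + ln 2 * (q - p).
  have m20 : 0 < 2 * m by lra.
  have := xlnx_tangent q_gt0 (ltW m20); have := xlnx_tangent q_gt0 (ltW m0).
  rewrite /xlnx lnM ?posrE//.
  move: (ln m) (ln q) (ln 2) => u v w H1 H2.
  have t0 : 0 <= p / m by rewrite divr_ge0// ltW.
  have t1 : 0 <= 1 - p / m by rewrite subr_ge0 ler_pdivrMr// /m; lra.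
  have {}H1 := ler_wpM2l t0 H1; have {}H2 := ler_wpM2l t1 H2.
  apply: le_trans (le_trans _ (lerD H1 H2)) _; rewrite le_eqVlt; apply/orP; left;
    apply/eqP; rewrite /m; field; lra.
by rewrite /jsd /xlnx -/m (_ : 2 * _ = p * ln m + q * ln m); [lra|rewrite /m; field].
Qed.

(** Minkowski's inequality in the Euclidean plane; it carries a triangle inequality for single atoms
    over to a sum of two atoms. *)
Lemma sqrt_minkowski2 (R : realType) (a b c d x y : R) :
  0 <= a -> 0 <= b -> 0 <= c -> 0 <= d -> 0 <= x -> 0 <= y ->
  Num.sqrt x <= Num.sqrt a + Num.sqrt b ->
  Num.sqrt y <= Num.sqrt c + Num.sqrt d ->
  Num.sqrt (x + y) <= Num.sqrt (a + c) + Num.sqrt (b + d).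
Proof.
move=> a0 b0 c0 d0 x0 y0 xab ycd.
have S z : 0 <= z -> exists2 s : R, 0 <= s & z = s ^+ 2.
  by move=> z0; exists (Num.sqrt z); rewrite ?sqr_sqrtr.
move: a0 b0 c0 d0 x0 y0 xab ycd.
move=> /S[A A0 ->] /S[B B0 ->] /S[C C0 ->] /S[D D0 ->] /S[X X0 ->] /S[Y Y0 ->].
rewrite !sqrtr_sqr !ger0_norm// => XAB YCD.
rewrite -ler_sqr ?nnegrE ?addr_ge0 ?sqrtr_ge0//.
rewrite sqrrD !sqr_sqrtr ?addr_ge0 ?sqr_ge0// -sqrtrM ?addr_ge0 ?sqr_ge0//.
(* Cauchy-Schwarz, from Lagrange's identity. *)
have : A * B + C * D <= Num.sqrt ((A ^+ 2 + C ^+ 2) * (B ^+ 2 + D ^+ 2)).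
  rewrite -[leLHS]ger0_norm ?addr_ge0 ?mulr_ge0// -sqrtr_sqr ler_wsqrtr//.
  rewrite -subr_ge0 (_ : _ - _ = (A * D - B * C) ^+ 2) ?sqr_ge0//; ring.
have X2 : X ^+ 2 <= (A + B) ^+ 2 by rewrite ler_sqr ?nnegrE ?addr_ge0.
have Y2 : Y ^+ 2 <= (C + D) ^+ 2 by rewrite ler_sqr ?nnegrE ?addr_ge0.
move: X2 Y2; rewrite !sqrrD !mulr2n; lra.
Qed.

(** * Densities with respect to a mixture *)

(** Allows the almost everywhere determined [density] to be replaced by a version with pointwise
    bounds. The last clause is the change of variables from P to M on nonnegative functions. *)
Definition is_density d (T : measurableType d) (R : realType)
    (P M : probability T R) (p : T -> R) : Prop :=
  [/\ measurable_fun setT p, ae_eq M setT (density P M) p &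
    forall (E : set T) (f : T -> \bar R), measurable E -> measurable_fun E f ->
      (forall x, 0 <= f x)%E ->
      (\int[M]_(x in E) (f x * (p x)%:E) = \int[P]_(x in E) f x)%E].

(** Passes from the charge derivative in [density] to a version that, under domination, is
    nonnegative and finite at every point. *)
Lemma ae_eq_density d (T : measurableType d) (R : realType)
    (P M : probability T R) : P `<< M ->
  ae_eq M setT (density P M)
    (fun x => fine (Radon_Nikodym_SigmaFinite.f P M x)).
Proof.
move=> PM; have /ae_eq_sym := ae_eq_Radon_Nikodym_SigmaFinite PM measurableT.
exact: (ae_eq_comp fine).
Qed.

Section mixture_density.
Context d (T : measurableType d) (R : realType).
Variables P Q : probability T R.

Lemma mixtureE (E : set T) :
  mixture P Q E = ((2^-1)%:E * (P E + Q E))%E.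
Proof. by rewrite -measure_addE. Qed.

Lemma mixture_double (E : set T) : (2%:E * mixture P Q E = P E + Q E)%E.
Proof. by rewrite mixtureE muleA -EFinM mulfV ?mul1e. Qed.

Lemma fine_mixture (E : set T) : measurable E ->
  fine (mixture P Q E) = (fine (P E) + fine (Q E)) / 2.
Proof.
move=> mE; rewrite mixtureE fineM ?fin_numD ?fin_num_measure//= mulrC.
by rewrite fineD ?fin_num_measure.
Qed.

Lemma dominates_mixturel : P `<< mixture P Q.
Proof.
apply/null_content_dominatesP => A mA MA0; apply/eqP.
rewrite eq_le measure_ge0 andbT -[leRHS](mule0 2%:E) -[in leRHS]MA0.
by rewrite mixture_double leeDl.
Qed.

Lemma dominates_mixturer : Q `<< mixture P Q.
Proof.
apply/null_content_dominatesP => A mA MA0; apply/eqP.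
rewrite eq_le measure_ge0 andbT -[leRHS](mule0 2%:E) -[in leRHS]MA0.
by rewrite mixture_double leeDr.
Qed.

(** As P + Q = 2 M, the derivatives F and G add up to 2 almost everywhere. Cutting F off at 2 and
    taking the complement to 2 changes them on a null set only and makes the bounds hold at every
    point. *)
Lemma mixture_densities : exists p q : T -> R,
  [/\ is_density P (mixture P Q) p, is_density Q (mixture P Q) q &
      forall x, [/\ 0 <= p x, 0 <= q x & p x + q x = 2]].
Proof.
pose M : probability T R := mixture P Q.
have PM : P `<< M := dominates_mixturel.
have QM : Q `<< M := dominates_mixturer.
pose F := Radon_Nikodym_SigmaFinite.f P M.
pose G := Radon_Nikodym_SigmaFinite.f Q M.
have F0 x : (0 <= F x)%E := Radon_Nikodym_SigmaFinite.f_ge0 PM x.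
have G0 x : (0 <= G x)%E := Radon_Nikodym_SigmaFinite.f_ge0 QM x.
have Ff x : F x \is a fin_num := Radon_Nikodym_SigmaFinite.f_fin_num PM x.
have Gf x : G x \is a fin_num := Radon_Nikodym_SigmaFinite.f_fin_num QM x.
have iF : M.-integrable setT F := Radon_Nikodym_SigmaFinite.f_integrable PM.
have iG : M.-integrable setT G := Radon_Nikodym_SigmaFinite.f_integrable QM.
have mF := measurable_int _ iF; have mG := measurable_int _ iG.
have FG2 : ae_eq M setT (F \+ G)%E (cst 2%:E).
  apply: integral_ae_eq => //; first exact: integrableD.
  move=> E _ mE; rewrite ge0_integralD//; [|exact: measurable_funTS..].
  rewrite -!Radon_Nikodym_SigmaFinite.f_integral// integral_cst//.
  by rewrite mixture_double.
pose p x := Num.min (fine (F x)) 2.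
pose q x := 2 - p x.
have mp : measurable_fun setT p.
  by apply: measurable_minr => //; exact: measurableT_comp.
have mq : measurable_fun setT q by exact: measurable_funB.
have pE : ae_eq M setT F (EFin \o p).
  apply: filterS FG2 => x /= /(_ Logic.I) H _.
  rewrite /p -[F x]fineK//= min_l// -lee_fin fineK// -H leeDl//.
have qE : ae_eq M setT G (EFin \o q).
  apply: filterS2 FG2 pE => x /= /(_ Logic.I) H /(_ Logic.I) Hp _.
  by rewrite /q EFinB -Hp -H addeAC subee ?add0e.
exists p, q; split.
- split=> //; first exact: ae_eq_trans (ae_eq_density PM) (ae_eq_comp fine pE).
  move=> E f mE mf f0.
  rewrite -(Radon_Nikodym_SigmaFinite.change_of_variables PM)//.
  apply: ae_eq_integral => //.
  + apply: emeasurable_funM => //; apply/measurable_EFinP.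
    exact: measurable_funTS.
  + by apply: emeasurable_funM => //; exact: measurable_funTS.
  + by apply: ae_eqe_mul2l; apply: ae_eq_subset (ae_eq_sym pE).
- split=> //; first exact: ae_eq_trans (ae_eq_density QM) (ae_eq_comp fine qE).
  move=> E f mE mf f0.
  rewrite -(Radon_Nikodym_SigmaFinite.change_of_variables QM)//.
  apply: ae_eq_integral => //.
  + apply: emeasurable_funM => //; apply/measurable_EFinP.
    exact: measurable_funTS.
  + by apply: emeasurable_funM => //; exact: measurable_funTS.
  + by apply: ae_eqe_mul2l; apply: ae_eq_subset (ae_eq_sym qE).
- move=> x; rewrite /q le_min fine_ge0//=; split => //; last by ring.
  by rewrite subr_ge0 ge_min lexx orbT.
Qed.
End mixture_density.

(** * Integrals of functions of bounded densities *)

Lemma xlnx_bounded (R : realType) (x : R) : 0 <= x <= 2 -> `|xlnx x| <= 2.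
Proof.
move=> /andP[x0 x2]; rewrite ler_norml; apply/andP; split.
  by have := xlnx_tangent ltr01 x0; rewrite ln1 mulr0; lra.
have [->|xn0] := eqVneq x 0; first by rewrite /xlnx mul0r; lra.
have xp : 0 < x by rewrite lt0r xn0.
have := ler_wpM2l x0 (ln_le_subr1 xp); rewrite /xlnx.
by nra.
Qed.

Lemma measurable_xlnx (R : realType) : measurable_fun setT (@xlnx R).
Proof. by apply: continuous_measurable_fun; exact: continuous_xlnx. Qed.

Section density_integrals.
Context d (T : measurableType d) (R : realType).
Implicit Types P Q M : probability T R.

Lemma bounded_integrable M (E : set T) (f : T -> R) (K : R) :
  measurable E -> measurable_fun setT f -> (forall x, `|f x| <= K) ->
  M.-integrable E (EFin \o f).
Proof.
move=> mE mf fK; apply: measurable_bounded_integrable => //.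
- by rewrite (le_lt_trans (probability_le1 _ _))// ltry.
- exact: measurable_funTS.
- exists K; split; first exact: num_real.
  by move=> k Kk x _; exact: le_trans (fK x) (ltW Kk).
Qed.

Lemma Rintegral_density P M (p : T -> R) (E : set T) :
  measurable E -> is_density P M p -> \int[M]_(x in E) p x = fine (P E).
Proof.
move=> mE [mp _ pP]; have := pP E (cst 1%E) mE (measurable_cst _) (fun=> lee01).
rewrite integral_cst// mul1e /Rintegral => <-.
by congr fine; apply: eq_integral => x _; rewrite mul1e.
Qed.

Lemma Rintegral_setC M (E : set T) (f : T -> R) (K : R) :
  measurable E -> measurable_fun setT f -> (forall x, `|f x| <= K) ->
  \int[M]_x f x = \int[M]_(x in E) f x + \int[M]_(x in ~` E) f x.
Proof.
move=> mE mf fK; rewrite -(setUv E) Rintegral_setU ?setUv//.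
- exact: measurableC.
- exact: bounded_integrable fK.
- by apply/disj_set2P; rewrite setICr.
Qed.

Lemma Rintegral_affine P Q M (p q : T -> R) (E : set T) (a b c : R) :
  measurable E -> is_density P M p -> is_density Q M q ->
  (forall x, 0 <= p x <= 2) -> (forall x, 0 <= q x <= 2) ->
  \int[M]_(x in E) (a * p x + b * q x + c) =
  a * fine (P E) + b * fine (Q E) + c * fine (M E).
Proof.
move=> mE dp dq p02 q02; have [mp _ _] := dp; have [mq _ _] := dq.
have ip : M.-integrable E (EFin \o p).
  apply: (@bounded_integrable M E p 2) => // x.
  by have /andP[? ?] := p02 x; rewrite ger0_norm.
have iq : M.-integrable E (EFin \o q).
  apply: (@bounded_integrable M E q 2) => // x.
  by have /andP[? ?] := q02 x; rewrite ger0_norm.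
have iap : M.-integrable E (EFin \o (fun x => a * p x)).
  exact: (integrableZl mE _ ip).
have ibq : M.-integrable E (EFin \o (fun x => b * q x)).
  exact: (integrableZl mE _ iq).
rewrite RintegralD//; last 2 first.
- exact: (integrableD mE iap ibq).
- apply: (@bounded_integrable M E (cst c) `|c|) => // x.
rewrite RintegralD// !RintegralZl// Rintegral_cst//.
by rewrite (Rintegral_density mE dp) (Rintegral_density mE dq).
Qed.

(** The common half of the Jensen-type bounds below: an integrand above a supporting affine function
    of the densities is integrated, and the affine part depends only on the masses of E. *)
Lemma affine_le_Rintegral P Q M (p q f : T -> R) (K : R) (E : set T) (a b c : R) :
  measurable E -> is_density P M p -> is_density Q M q ->
  (forall x, 0 <= p x <= 2) -> (forall x, 0 <= q x <= 2) ->
  measurable_fun setT f -> (forall x, `|f x| <= K) ->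
  (forall x, a * p x + b * q x + c <= f x) ->
  a * fine (P E) + b * fine (Q E) + c * fine (M E) <= \int[M]_(x in E) f x.
Proof.
move=> mE dp dq p02 q02 mf fK le_f.
have [mp _ _] := dp; have [mq _ _] := dq.
rewrite -(Rintegral_affine a b c mE dp dq)//; apply: le_Rintegral => //.
- apply: (@bounded_integrable M E _ (`|a| * 2 + `|b| * 2 + `|c|)) => //.
    apply: measurable_funD => //; apply: measurable_funD; exact: measurable_funM.
  move=> x; have /andP[? ?] := p02 x; have /andP[? ?] := q02 x.
  rewrite (le_trans (ler_normD _ _))// lerD2r (le_trans (ler_normD _ _))//.
  by rewrite lerD// normrM ler_wpM2l// ger0_norm.
- exact: bounded_integrable fK.
Qed.

Lemma measurable_density P M : P `<< M -> measurable_fun setT (density P M).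
Proof. by move=> PM; exact: measurableT_comp. Qed.

Lemma KL_densityE P M (p : T -> R) (b : R) :
  P `<< M -> is_density P M p -> (forall x, 0 <= p x <= 2) ->
  KL b P M = (\int[M]_x xlnx (p x) / ln b)%:E.
Proof.
move=> PM [mp dp pP] p02; rewrite /KL asboolT//.
have mdens := measurable_density PM.
have mlogb : measurable_fun setT (@logb R b).
  by apply: measurable_funM => //; exact: measurable_ln.
(* An M-null set is P-null, so p may replace the density under P as well. *)
have dpP := null_dominates_ae_eq measurableT PM dp.
transitivity (\int[P]_x (logb b (p x))%:E)%E.
  apply: ae_eq_integral => //.
  - by apply/measurable_EFinP; exact: measurableT_comp.
  - by apply/measurable_EFinP; exact: measurableT_comp.
  - exact: (ae_eq_comp (fun y => (logb b y)%:E) dpP).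
pose f x := (logb b (p x))%:E.
have mf : measurable_fun setT f.
  by apply/measurable_EFinP; exact: measurableT_comp.
have mx : measurable_fun setT (fun x => xlnx (p x)).
  by apply: measurableT_comp => //; exact: measurable_xlnx.
have ix : M.-integrable setT (EFin \o (fun x => xlnx (p x))).
  by apply: (@bounded_integrable M _ _ 2) => // x; exact: xlnx_bounded.
(* The logarithm changes sign, so the change of variables is applied to its positive and negative
   parts separately. *)
transitivity (\int[M]_x (f x * (p x)%:E))%E.
  rewrite integralE [RHS]integralE; congr (_ - _)%E.
  - rewrite -pP//; last by exact: measurable_funepos.
    apply: eq_integral => x _; rewrite !funeposE maxe_pMl// ?mul0e//.
    by have /andP[] := p02 x.
  - rewrite -pP//; last by exact: measurable_funeneg.
    apply: eq_integral => x _; rewrite !funenegE maxe_pMl// ?mul0e ?mulNe//.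
    by have /andP[] := p02 x.
transitivity (\int[M]_x ((ln b)^-1%:E * (xlnx (p x))%:E))%E.
  apply: eq_integral => x _; rewrite /f -!EFinM /logb /xlnx.
  by congr EFin; rewrite mulrAC mulrC [_ * p x]mulrC.
rewrite integralZl// /Rintegral EFinM muleC fineK//; exact: integrable_fin_num.
Qed.

(** Jensen's inequality for x ln x on E: the tangent at c is integrated, and the best c is the mean
    density P(E) / M(E). *)
Lemma xlnx_le_Rintegral P M (p : T -> R) (E : set T) :
  measurable E -> is_density P M p -> (forall x, 0 <= p x <= 2) ->
  xlnx (fine (P E)) - fine (P E) * ln (fine (M E)) <=
  \int[M]_(x in E) xlnx (p x).
Proof.
move=> mE dp p02; have [mp _ _] := dp.
have tangent c : 0 < c ->
    fine (P E) * (ln c + 1) - c * fine (M E) <= \int[M]_(x in E) xlnx (p x).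
  move=> c0.
  have := @affine_le_Rintegral P P M p p (fun x => xlnx (p x)) 2 E
    (ln c + 1) 0 (- c) mE dp dp p02 p02.
  rewrite mul0r addr0 mulNr mulrC; apply.
  - by apply: measurableT_comp => //; exact: measurable_xlnx.
  - by move=> x; exact: xlnx_bounded.
  - move=> x; have /andP[px _] := p02 x.
    by have := xlnx_tangent c0 px; lra.
have PE0 : 0 <= fine (P E) by rewrite fine_ge0.
have ME0 : 0 <= fine (M E) by rewrite fine_ge0.
have ME1 : fine (M E) <= 1.
  by rewrite -[leRHS]/(fine 1%E) fine_le ?fin_num_measure// probability_le1.
(* The optimal c would be 0, which has no tangent; c = e for arbitrarily small e > 0 gives the bound
   up to e, since M(E) <= 1. *)
have [PE|PE] := eqVneq (fine (P E)) 0.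
  rewrite PE /xlnx !mul0r subrr; apply/ler_addgt0Pr => e e0.
  by have := tangent _ e0; rewrite PE mul0r; nra.
have {}PE0 : 0 < fine (P E) by rewrite lt0r PE.
have {}ME0 : 0 < fine (M E).
  have : fine (P E) <= 2 * fine (M E).
    rewrite -(Rintegral_density mE dp) -Rintegral_cst//.
    apply: le_Rintegral => //.
    + apply: (@bounded_integrable M E p 2) => // x.
      by have /andP[? ?] := p02 x; rewrite ger0_norm.
    + by apply: (@bounded_integrable M E (cst 2) 2) => // x; rewrite ger0_norm.
    + by move=> x _; have /andP[] := p02 x.
  by lra.
have := tangent _ (divr_gt0 PE0 ME0).
rewrite ln_div// divfK ?gt_eqF// /xlnx.
by lra.
Qed.

(** For every l > 0, (s - t)^2 exceeds (1 - l) s^2 + (1 - 1/l) t^2 by (l s - t)^2 / l. With s^2 = p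
    and t^2 = q the lower bound is linear in the densities; it is integrated and l is then
    chosen. *)
Lemma sqrt_le_Rintegral P Q M (p q : T -> R) (E : set T) :
  measurable E -> is_density P M p -> is_density Q M q ->
  (forall x, 0 <= p x <= 2) -> (forall x, 0 <= q x <= 2) ->
  (Num.sqrt (fine (P E)) - Num.sqrt (fine (Q E))) ^+ 2 <=
  \int[M]_(x in E) (Num.sqrt (p x) - Num.sqrt (q x)) ^+ 2.
Proof.
move=> mE dp dq p02 q02; have [mp _ _] := dp; have [mq _ _] := dq.
have ms : measurable_fun setT (@Num.sqrt R).
  by apply: continuous_measurable_fun; exact: sqrt_continuous.
have tangent l : 0 < l -> (1 - l) * fine (P E) + (1 - l^-1) * fine (Q E) <=
    \int[M]_(x in E) (Num.sqrt (p x) - Num.sqrt (q x)) ^+ 2.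
  move=> l0.
  have := @affine_le_Rintegral P Q M p q
    (fun x => (Num.sqrt (p x) - Num.sqrt (q x)) ^+ 2) 4 E
    (1 - l) (1 - l^-1) 0 mE dp dq p02 q02.
  rewrite mul0r addr0; apply.
  - by apply: measurable_funX; apply: measurable_funB; exact: measurableT_comp.
  - move=> x; have /andP[p0 p2] := p02 x; have /andP[q0 q2] := q02 x.
    rewrite ger0_norm ?sqr_ge0// sqrrB !sqr_sqrtr//.
    have : 0 <= Num.sqrt (p x) * Num.sqrt (q x) by rewrite mulr_ge0 ?sqrtr_ge0.
    by rewrite mulr2n; lra.
  - move=> x; have /andP[p0 p2] := p02 x; have /andP[q0 q2] := q02 x.
    rewrite -{1}(sqr_sqrtr p0) -{1}(sqr_sqrtr q0) addr0.
    move: (Num.sqrt (p x)) (Num.sqrt (q x)) => s t.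
    rewrite -subr_ge0 (_ : _ - _ = l^-1 * (l * s - t) ^+ 2).
      by rewrite mulr_ge0 ?sqr_ge0// invr_ge0 ltW.
    by field; rewrite gt_eqF.
have : 0 <= fine (P E) by rewrite fine_ge0.
have : 0 <= fine (Q E) by rewrite fine_ge0.
move: (fine (P E)) (fine (Q E)) tangent => x y tangent y0 x0.
have := sqr_sqrtr x0; have := sqr_sqrtr y0.
have := sqrtr_ge0 x; have := sqrtr_ge0 y.
move: (Num.sqrt x) (Num.sqrt y) => s t t0 s0 yt xs.
apply/ler_addgt0Pr => e e0.
pose k := e / (s + t + 1).
have k0 : 0 < k by apply: divr_gt0 => //; lra.
have kst : k * (s + t) <= e.
  by rewrite /k mulrAC ler_pdivrMr ?ler_wpM2l//; [exact: ltW|lra|lra].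
have sk : 0 < s + k by lra.
have tk : 0 < t + k by lra.
(* The weight t / s is optimal; the shift by k keeps it positive and finite. *)
apply: (le_trans _ (lerD (tangent _ (divr_gt0 tk sk)) (lexx e))).
rewrite invf_div -xs -yt.
have h1 : (t + k) / (s + k) * s ^+ 2 <= (t + k) * s.
  rewrite -mulrA ler_wpM2l ?(ltW tk)// mulrC ler_pdivrMr// expr2 ler_wpM2l//.
  lra.
have h2 : (s + k) / (t + k) * t ^+ 2 <= (s + k) * t.
  rewrite -mulrA ler_wpM2l ?(ltW sk)// mulrC ler_pdivrMr// expr2 ler_wpM2l//.
  lra.
by move: h1 h2; rewrite sqrrB mulr2n; lra.
Qed.

End density_integrals.

(** * Divergences and binary quantization *)

(** For Bernoulli laws of parameters x and y, [js2] is twice the Jensen-Shannon divergence in base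
    e, and [hel2] twice the squared Hellinger distance. *)
Definition js2 (R : realType) (x y : R) : R := jsd x y + jsd (1 - x) (1 - y).

Definition hel2 (R : realType) (x y : R) : R :=
  (Num.sqrt x - Num.sqrt y) ^+ 2 + (Num.sqrt (1 - x) - Num.sqrt (1 - y)) ^+ 2.

Lemma sqrt_js2_triangle (R : realType) (x y z : R) :
  0 <= x <= 1 -> 0 <= y <= 1 -> 0 <= z <= 1 ->
  Num.sqrt (js2 x z) <= Num.sqrt (js2 x y) + Num.sqrt (js2 y z).
Proof.
move=> /andP[x0 x1] /andP[y0 y1] /andP[z0 z1].
by apply: sqrt_minkowski2; rewrite ?jsd_ge0 ?subr_ge0//;
  apply: sqrt_jsd_triangle; rewrite ?subr_ge0.
Qed.

Lemma js2_le_dist (R : realType) (x y : R) : 0 <= x <= 1 -> 0 <= y <= 1 ->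
  js2 x y <= 2 * ln 2 * `|x - y|.
Proof.
move=> /andP[x0 x1] /andP[y0 y1].
have h1 := jsd_le_dist x0 y0.
have h2 : jsd (1 - x) (1 - y) <= ln 2 * `|x - y|.
  rewrite distrC (_ : y - x = (1 - x) - (1 - y)); last by ring.
  by apply: jsd_le_dist; rewrite subr_ge0.
by rewrite /js2; lra.
Qed.

Lemma sqrt_hel2_triangle (R : realType) (x y z : R) :
  Num.sqrt (hel2 x z) <= Num.sqrt (hel2 x y) + Num.sqrt (hel2 y z).
Proof.
by apply: sqrt_minkowski2; rewrite ?sqr_ge0// !sqrtr_sqr; exact: ler_distD.
Qed.

(** With s and t the square roots, |s - t| <= s + t, and |s - t| (s + t) = |x - y|. *)
Lemma sqr_sqrt_le_dist (R : realType) (x y : R) : 0 <= x -> 0 <= y ->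
  (Num.sqrt x - Num.sqrt y) ^+ 2 <= `|x - y|.
Proof.
move=> x0 y0; rewrite -real_normK ?num_real//.
rewrite -{2}(sqr_sqrtr x0) -{2}(sqr_sqrtr y0) subr_sqr normrM expr2.
rewrite ler_wpM2l// [leRHS]ger0_norm ?addr_ge0 ?sqrtr_ge0//.
have := sqrtr_ge0 x; have := sqrtr_ge0 y.
by rewrite ler_norml => ? ?; lra.
Qed.

Lemma hel2_le_dist (R : realType) (x y : R) : 0 <= x <= 1 -> 0 <= y <= 1 ->
  hel2 x y <= 2 * `|x - y|.
Proof.
move=> /andP[x0 x1] /andP[y0 y1].
have h1 := sqr_sqrt_le_dist x0 y0.
have h2 : (Num.sqrt (1 - x) - Num.sqrt (1 - y)) ^+ 2 <= `|x - y|.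
  rewrite distrC (_ : y - x = (1 - x) - (1 - y)); last by ring.
  by apply: sqr_sqrt_le_dist; rewrite subr_ge0.
by rewrite /hel2; lra.
Qed.

Lemma measurable_sqr_sqrtB d (T : measurableType d) (R : realType)
    (p q : T -> R) : measurable_fun setT p -> measurable_fun setT q ->
  measurable_fun setT (fun x => (Num.sqrt (p x) - Num.sqrt (q x)) ^+ 2).
Proof.
have ms : measurable_fun setT (@Num.sqrt R).
  by apply: continuous_measurable_fun; exact: sqrt_continuous.
move=> mp mq; apply: measurable_funX.
by apply: measurable_funB; exact: measurableT_comp.
Qed.

Section divergence_of_densities.
Context d (T : measurableType d) (R : realType).
Variables P Q : probability T R.

Lemma JS_densityE (b : R) (p q : T -> R) :
  is_density P (mixture P Q) p -> is_density Q (mixture P Q) q ->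
  (forall x, 0 <= p x <= 2) -> (forall x, 0 <= q x <= 2) ->
  fine (JS b P Q) = (2 * ln b)^-1 *
    (\int[mixture P Q]_x xlnx (p x) + \int[mixture P Q]_x xlnx (q x)).
Proof.
move=> dp dq p02 q02; rewrite /JS.
rewrite (KL_densityE b (@dominates_mixturel _ _ _ P Q) dp p02).
rewrite (KL_densityE b (@dominates_mixturer _ _ _ P Q) dq q02).
by rewrite -EFinD -EFinM/= -mulrDl invfM; ring.
Qed.

Lemma Hellinger2_densityE (p q : T -> R) :
  is_density P (mixture P Q) p -> is_density Q (mixture P Q) q ->
  Hellinger2 P Q = 2^-1 *
    \int[mixture P Q]_x (Num.sqrt (p x) - Num.sqrt (q x)) ^+ 2.
Proof.
move=> dp dq; rewrite /Hellinger2 /Rintegral; congr (_ * fine _).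
have [mp dP _] := dp; have [mq dQ _] := dq.
apply: ae_eq_integral => //.
- apply/measurable_EFinP/measurable_sqr_sqrtB; apply: measurable_density.
    exact: dominates_mixturel.
  exact: dominates_mixturer.
- by apply/measurable_EFinP; exact: measurable_sqr_sqrtB.
- by apply: filterS2 dP dQ => x /= /(_ Logic.I) -> /(_ Logic.I) ->.
Qed.

End divergence_of_densities.

Lemma fine_probability_setC d (T : measurableType d) (R : realType)
    (P : probability T R) (E : set T) : measurable E ->
  fine (P (~` E)) = 1 - fine (P E).
Proof.
by move=> mE; rewrite probability_setC// fineB ?fin_num_measure.
Qed.

Lemma fine_probability_itv d (T : measurableType d) (R : realType)
    (P : probability T R) (E : set T) : measurable E -> 0 <= fine (P E) <= 1.
Proof.
move=> mE; rewrite fine_ge0//=.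
by rewrite -[leRHS]/(fine 1%E) fine_le ?fin_num_measure// probability_le1.
Qed.

(** The mixture gives E the midpoint of P(E) and Q(E), so [jsd] splits into the two lower bounds of
    [xlnx_le_Rintegral]. *)
Lemma jsd_mixtureE d (T : measurableType d) (R : realType)
    (P Q : probability T R) (E : set T) : measurable E ->
  jsd (fine (P E)) (fine (Q E)) =
  (xlnx (fine (P E)) - fine (P E) * ln (fine (mixture P Q E))) +
  (xlnx (fine (Q E)) - fine (Q E) * ln (fine (mixture P Q E))).
Proof.
by move=> mE; rewrite fine_mixture// /jsd [xlnx (_ / 2)]/xlnx; field.
Qed.

Lemma mixture_densities_bound d (T : measurableType d) (R : realType)
    (P Q : probability T R) : exists p q : T -> R,
  [/\ is_density P (mixture P Q) p, is_density Q (mixture P Q) q,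
      forall x, 0 <= p x <= 2 & forall x, 0 <= q x <= 2].
Proof.
have [p [q [dp dq pq]]] := mixture_densities P Q.
by exists p, q; split => // x; have [? ? ?] := pq x; apply/andP; split; lra.
Qed.

Lemma sqr_sqrtB_bounded (R : realType) (x y : R) :
  0 <= x <= 2 -> 0 <= y <= 2 -> `|(Num.sqrt x - Num.sqrt y) ^+ 2| <= 2.
Proof.
move=> /andP[x0 x2] /andP[y0 y2]; rewrite ger0_norm ?sqr_ge0//.
by apply: le_trans (sqr_sqrt_le_dist x0 y0) _; rewrite ler_norml; lra.
Qed.

(* Together with [hel2_le_Hellinger2]: the data-processing inequality for the
   indicator of E. *)
Lemma js2_le_JS d (T : measurableType d) (R : realType) (b : R)
    (P Q : probability T R) (E : set T) : 1 < b -> measurable E ->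
  (2 * ln b)^-1 * js2 (fine (P E)) (fine (Q E)) <= fine (JS b P Q).
Proof.
move=> b1 mE; have lb : 0 < ln b by rewrite ln_gt0.
have [p [q [dp dq p02 q02]]] := mixture_densities_bound P Q.
have [mp _ _] := dp; have [mq _ _] := dq.
rewrite (JS_densityE b dp dq p02 q02) ler_wpM2l ?invr_ge0 ?mulr_ge0 ?(ltW lb)//.
have mx := @measurable_xlnx R; have mEC := measurableC mE.
have split (f : T -> R) : measurable_fun setT f -> (forall x, 0 <= f x <= 2) ->
    \int[mixture P Q]_x xlnx (f x) = \int[mixture P Q]_(x in E) xlnx (f x) +
      \int[mixture P Q]_(x in ~` E) xlnx (f x).
  move=> mf f02; apply: (Rintegral_setC (K := 2) _) => //.
    exact: measurableT_comp.
  by move=> x; exact: xlnx_bounded.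
rewrite !split// /js2 -!fine_probability_setC// !jsd_mixtureE//.
have := xlnx_le_Rintegral mE dp p02.
have := xlnx_le_Rintegral mE dq q02.
have := xlnx_le_Rintegral mEC dp p02.
have := xlnx_le_Rintegral mEC dq q02.
by lra.
Qed.

Lemma hel2_le_Hellinger2 d (T : measurableType d) (R : realType)
    (P Q : probability T R) (E : set T) : measurable E ->
  2^-1 * hel2 (fine (P E)) (fine (Q E)) <= Hellinger2 P Q.
Proof.
move=> mE; have mEC := measurableC mE.
have [p [q [dp dq p02 q02]]] := mixture_densities_bound P Q.
have [mp _ _] := dp; have [mq _ _] := dq.
rewrite (Hellinger2_densityE dp dq) ler_wpM2l//.
rewrite (Rintegral_setC (K := 2) _ mE); last 2 first.
- exact: measurable_sqr_sqrtB.
- by move=> x; exact: sqr_sqrtB_bounded.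
rewrite /hel2 -!fine_probability_setC//.
by apply: lerD; apply: sqrt_le_Rintegral.
Qed.

(** * Exact formulas for laws on two points *)

Lemma Rintegral_atom d (T : measurableType d) (R : realType)
    (M : probability T R) (E : set T) (y : T) (f : T -> R) :
  measurable E -> (forall x, E x -> x = y) ->
  \int[M]_(x in E) f x = f y * fine (M E).
Proof.
move=> mE Ey; rewrite -Rintegral_cst//; apply: eq_Rintegral => x /set_mem Ex.
by rewrite (Ey _ Ex).
Qed.

(** The equality case of [xlnx_le_Rintegral]: E has at most one point, so P(E) = p(y) M(E). If
    either factor is 0, both sides vanish. *)
Lemma xlnx_Rintegral_atom d (T : measurableType d) (R : realType)
    (P M : probability T R) (E : set T) (y : T) (p : T -> R) :
  measurable E -> (forall x, E x -> x = y) -> is_density P M p ->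
  0 <= p y ->
  xlnx (fine (P E)) - fine (P E) * ln (fine (M E)) =
  \int[M]_(x in E) xlnx (p x).
Proof.
move=> mE Ey dp p0.
rewrite -(Rintegral_density mE dp) !(Rintegral_atom _ _ mE Ey).
have /andP[+ _] := fine_probability_itv M mE.
rewrite le_eqVlt => /predU1P[<-|M0]; first by rewrite /xlnx !mulr0 !mul0r subrr.
move: p0; rewrite le_eqVlt => /predU1P[<-|p0].
  by rewrite /xlnx !mul0r subrr.
by rewrite /xlnx lnM//; ring.
Qed.

Lemma sqrt_Rintegral_atom d (T : measurableType d) (R : realType)
    (P Q M : probability T R) (E : set T) (y : T) (p q : T -> R) :
  measurable E -> (forall x, E x -> x = y) ->
  is_density P M p -> is_density Q M q -> 0 <= p y -> 0 <= q y ->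
  (Num.sqrt (fine (P E)) - Num.sqrt (fine (Q E))) ^+ 2 =
  \int[M]_(x in E) (Num.sqrt (p x) - Num.sqrt (q x)) ^+ 2.
Proof.
move=> mE Ey dp dq p0 q0; have /andP[M0 _] := fine_probability_itv M mE.
rewrite -(Rintegral_density mE dp) -(Rintegral_density mE dq).
rewrite !(Rintegral_atom _ _ mE Ey) !sqrtrM// -mulrBl exprMn sqr_sqrtr//.
Qed.

Lemma JS_bool (R : realType) (b : R) (P Q : probability bool R) :
  fine (JS b P Q) =
  (2 * ln b)^-1 * js2 (fine (P [set true])) (fine (Q [set true])).
Proof.
have [p [q [dp dq p02 q02]]] := mixture_densities_bound P Q.
have [mp _ _] := dp; have [mq _ _] := dq.
rewrite (JS_densityE b dp dq p02 q02); congr (_ * _).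
have mx := @measurable_xlnx R.
have mE : measurable [set true] by [].
have mEC : measurable (~` [set true]) by [].
have split (f : bool -> R) : measurable_fun setT f -> (forall x, 0 <= f x <= 2) ->
    \int[mixture P Q]_x xlnx (f x) =
      \int[mixture P Q]_(x in [set true]) xlnx (f x) +
      \int[mixture P Q]_(x in ~` [set true]) xlnx (f x).
  move=> mf f02; apply: (Rintegral_setC (K := 2) _) => //.
  by move=> x; exact: xlnx_bounded.
have p0 x : 0 <= p x by have /andP[] := p02 x.
have q0 x : 0 <= q x by have /andP[] := q02 x.
have Et x : [set true] x -> x = true by [].
have Ef x : (~` [set true]) x -> x = false by case: x => /= H; [case: H|].
rewrite !split// /js2 -!fine_probability_setC// !jsd_mixtureE//.
rewrite !(xlnx_Rintegral_atom mE Et dp)// !(xlnx_Rintegral_atom mE Et dq)//.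
rewrite !(xlnx_Rintegral_atom mEC Ef dp)// !(xlnx_Rintegral_atom mEC Ef dq)//.
by ring.
Qed.

Lemma Hellinger2_bool (R : realType) (P Q : probability bool R) :
  Hellinger2 P Q = 2^-1 * hel2 (fine (P [set true])) (fine (Q [set true])).
Proof.
have [p [q [dp dq p02 q02]]] := mixture_densities_bound P Q.
have [mp _ _] := dp; have [mq _ _] := dq.
have mE : measurable [set true] by [].
have mEC : measurable (~` [set true]) by [].
have p0 x : 0 <= p x by have /andP[] := p02 x.
have q0 x : 0 <= q x by have /andP[] := q02 x.
have Et x : [set true] x -> x = true by [].
have Ef x : (~` [set true]) x -> x = false by case: x => /= H; [case: H|].
rewrite (Hellinger2_densityE dp dq); congr (_ * _).
rewrite (Rintegral_setC (K := 2) _ mE); last 2 first.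
- exact: measurable_sqr_sqrtB.
- by move=> x; exact: sqr_sqrtB_bounded.
rewrite /hel2 -!fine_probability_setC//.
by rewrite (sqrt_Rintegral_atom mE Et dp dq)// (sqrt_Rintegral_atom mEC Ef dp dq).
Qed.

(** * Total variation and the passage to classification errors *)

Lemma dTV_ge d (T : measurableType d) (R : realType)
    (P Q : probability T R) (E : set T) : measurable E ->
  `|fine (P E) - fine (Q E)| <= dTV P Q.
Proof.
move=> mE; apply: ub_le_sup; last by exists E.
(* A real [sup] dominates the members of a set once the set is bounded above. *)
exists 1 => _ [F mF <-].
have /andP[? ?] := fine_probability_itv P mF.
have /andP[? ?] := fine_probability_itv Q mF.
by rewrite ler_norml; apply/andP; split; lra.
Qed.

Lemma dTV_bool_le (R : realType) (P Q : probability bool R) :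
  dTV P Q <= `|fine (P [set true]) - fine (Q [set true])|.
Proof.
apply: ge_sup.
  by exists `|fine (P set0) - fine (Q set0)|, set0.
move=> _ [E mE <-].
have [Et|Et] := pselect (E true); have [Ef|Ef] := pselect (E false).
- have -> : E = setT by apply/seteqP; split=> // -[].
  by rewrite !probability_setT subrr normr0.
- have -> // : E = [set true] by apply/seteqP; split=> -[].
- have -> : E = ~` [set true].
    by apply/seteqP; split=> -[] //= H; exfalso; exact: H.
  rewrite !fine_probability_setC// distrC.
  by rewrite le_eqVlt; apply/orP; left; apply/eqP; congr `|_|; ring.
- have -> : E = set0 by apply/seteqP; split=> -[].
  by rewrite !measure0 subrr normr0.
Qed.

(** The argument shared by Jensen-Shannon and Hellinger: D is the squared distance of Bernoulli
    laws, the y's and z's are the probabilities of Y = 1 and Yhat = 1 in each group, and dF is the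
    distance of the feature laws. *)
Lemma sqr_gap_le (R : realType) (D : R -> R -> R) (y0 y1 z0 z1 e0 e1 : R) :
  (forall x y z, 0 <= x <= 1 -> 0 <= y <= 1 -> 0 <= z <= 1 ->
    Num.sqrt (D x z) <= Num.sqrt (D x y) + Num.sqrt (D y z)) ->
  (forall x y, 0 <= x <= 1 -> 0 <= y <= 1 -> D x y <= `|x - y|) ->
  0 <= y0 <= 1 -> 0 <= y1 <= 1 -> 0 <= z0 <= 1 -> 0 <= z1 <= 1 ->
  `|y0 - z0| <= e0 -> `|y1 - z1| <= e1 ->
  forall dY dF, dY <= Num.sqrt (D y0 y1) -> Num.sqrt (D z0 z1) <= dF ->
  dF <= dY -> 2^-1 * (dY - dF) ^+ 2 <= e0 + e1.
Proof.
move=> tri le_dist Iy0 Iy1 Iz0 Iz1 ye0 ye1 dY dF DY DF FY.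
have t1 := tri _ _ _ Iy0 Iz0 Iy1; have t2 := tri _ _ _ Iz0 Iz1 Iy1.
have h0 : Num.sqrt (D y0 z0) <= Num.sqrt e0.
  by apply: ler_wsqrtr; apply: le_trans ye0; exact: le_dist.
have h1 : Num.sqrt (D z1 y1) <= Num.sqrt e1.
  by apply: ler_wsqrtr; apply: le_trans ye1; rewrite distrC; exact: le_dist.
have e00 : 0 <= e0 := le_trans (normr_ge0 _) ye0.
have e10 : 0 <= e1 := le_trans (normr_ge0 _) ye1.
have s0 := sqrtr_ge0 e0; have s1 := sqrtr_ge0 e1.
rewrite -(sqr_sqrtr e00) -(sqr_sqrtr e10).
move: (Num.sqrt e0) (Num.sqrt e1) s0 s1 h0 h1 => u v u0 v0 h0 h1.
have gap0 : 0 <= dY - dF by rewrite subr_ge0.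
have gap : dY - dF <= u + v by lra.
have uv0 := addr_ge0 u0 v0.
have : (dY - dF) ^+ 2 <= (u + v) ^+ 2 by rewrite ler_sqr ?nnegrE.
(* (u + v)^2 + (u - v)^2 = 2 (u^2 + v^2). *)
move: ((dY - dF) ^+ 2) => G; have := sqr_ge0 (u - v).
by rewrite sqrrB sqrrD; lra.
Qed.

(** The set where f and g differ is the symmetric difference of the two events, so each event is
    covered by the other together with that set. *)
Lemma dist_probability_le_neq d (T : measurableType d) (R : realType)
    (P : probability T R) (f g : {mfun T >-> bool}) :
  `|fine (P (f @^-1` [set true])) - fine (P (g @^-1` [set true]))| <=
  fine (P [set x | f x != g x]).
Proof.
set F := f @^-1` _; set G := g @^-1` _; set N := [set x | _].
have mF : measurable F by rewrite -[F]setTI; exact: measurable_funPT.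
have mG : measurable G by rewrite -[G]setTI; exact: measurable_funPT.
have NE : N = (F `\` G) `|` (G `\` F).
  apply/seteqP; split=> x; rewrite /N /F /G /=.
    by case: (f x); case: (g x) => // _; [left|right]; split.
  by case: (f x); case: (g x) => // -[] [].
have mN : measurable N by rewrite NE; apply: measurableU; exact: measurableD.
have sub (A B : set T) : measurable A -> measurable B -> A `<=` B `|` N ->
    fine (P A) <= fine (P B) + fine (P N).
  move=> mA mB AB; rewrite -fineD ?fin_num_measure// fine_le ?fin_numD ?fin_num_measure//.
  apply: le_trans (measureU2 P mB mN).
  by apply: le_measure; rewrite ?inE//; exact: measurableU.
have h1 : fine (P F) <= fine (P G) + fine (P N).
  apply: sub => // x Fx; rewrite NE.
  by have [Gx|Gx] := pselect (G x); [left|right; left].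
have h2 : fine (P G) <= fine (P F) + fine (P N).
  apply: sub => // x Gx; rewrite NE.
  by have [Fx|Fx] := pselect (F x); [left|right; right].
by rewrite ler_norml; apply/andP; split; lra.
Qed.

Theorem theorem18 (R : realType) (b : R) (hb : b = 2 \/ b = expR 1)
    (n : nat) (X : set (n.-tuple R)) (x0 : X)
    (mu : probability (trace_space x0 * bool * bool)%type R)
    (hA : forall a : bool, (0 < mu [set w | coordA w = a])%E)
    (dZ : measure_display) (Z : measurableType dZ)
    (g : {mfun trace_space x0 >-> Z}) (h : {mfun Z >-> bool})
    (hJS : dJS b (law_feature mu g false) (law_feature mu g true)
           <= dJS b (lawY mu false) (lawY mu true))
    (hH : Hellinger (law_feature mu g false) (law_feature mu g true)
          <= Hellinger (lawY mu false) (lawY mu true)) :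
  [/\ dTV (lawY mu false) (lawY mu true)
        - dTV (law_feature mu g false) (law_feature mu g true)
      <= Err mu false (h \o g) + Err mu true (h \o g),
      2^-1 * (dJS b (lawY mu false) (lawY mu true)
              - dJS b (law_feature mu g false) (law_feature mu g true)) ^+ 2
      <= Err mu false (h \o g) + Err mu true (h \o g) &
      2^-1 * (Hellinger (lawY mu false) (lawY mu true)
              - Hellinger (law_feature mu g false) (law_feature mu g true)) ^+ 2
      <= Err mu false (h \o g) + Err mu true (h \o g)].
Proof.
pose y a := fine (lawY mu a [set true]).
pose E := h @^-1` [set true].
have mE : measurable E by rewrite -[E]setTI; exact: measurable_funPT.
pose z a := fine (law_feature mu g a E).
have Iy a : 0 <= y a <= 1 by exact: fine_probability_itv.
have Iz a : 0 <= z a <= 1 by exact: fine_probability_itv.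
have yz a : `|y a - z a| <= Err mu a (h \o g).
  pose Yhat : {mfun (trace_space x0 * bool * bool)%type >-> bool} :=
    h \o @feature _ _ _ _ g.
  (* Unfolding the pushforwards, [y a] and [z a] are the probabilities of Y = 1 and Yhat = 1 under
     [cond mu a], and [Err] is that of Y != Yhat. *)
  exact: (dist_probability_le_neq (cond mu a) (@coordY _ _) Yhat).
have ln2 : 0 < ln (2 : R) by rewrite ln_gt0// ltr1n.
have b1 : 1 < b by case: hb => ->; rewrite ?ltr1n// expR_gt1.
(* In base b the divergence of Bernoulli laws is at most (ln 2 / ln b) |x - y|, and this factor must
   not exceed 1. *)
have lb : ln 2 <= ln b.
  case: hb => -> //; rewrite expRK; have := @ln_le_subr1 R 2 (ltr0Sn _ _).
  by lra.
have lb0 : 0 < ln b := lt_le_trans ln2 lb.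
split.
(* Here the triangle inequality is the one for real numbers, along y_0, z_0, z_1, y_1. *)
- have := dTV_bool_le (lawY mu false) (lawY mu true).
  have := dTV_ge (law_feature mu g false) (law_feature mu g true) mE.
  rewrite -/(y false) -/(y true) -/(z false) -/(z true).
  have := yz false; have := yz true.
  have := ler_distD (z false) (y false) (y true).
  have := ler_distD (z true) (z false) (y true).
  by rewrite (distrC (z true)); lra.
- apply: (@sqr_gap_le R (fun u v => (2 * ln b)^-1 * js2 u v) _ _ _ _ _ _ _ _
    (Iy false) (Iy true) (Iz false) (Iz true) (yz false) (yz true)) => //.
  + move=> u v w Iu Iv Iw.
    rewrite !sqrtrM ?invr_ge0 ?mulr_ge0 ?(ltW lb0)// -mulrDr.
    by rewrite ler_wpM2l ?sqrtr_ge0//; exact: sqrt_js2_triangle.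
  + move=> u v Iu Iv; rewrite ler_pdivrMl ?mulr_gt0//.
    apply: le_trans (js2_le_dist Iu Iv) _.
    by rewrite ler_wpM2r// ler_wpM2l.
  + by rewrite /dJS JS_bool.
  + by apply: ler_wsqrtr; exact: js2_le_JS.
- apply: (@sqr_gap_le R (fun u v => 2^-1 * hel2 u v) _ _ _ _ _ _ _ _
    (Iy false) (Iy true) (Iz false) (Iz true) (yz false) (yz true)) => //.
  + move=> u v w _ _ _; rewrite !sqrtrM ?invr_ge0// -mulrDr.
    by rewrite ler_wpM2l ?sqrtr_ge0//; exact: sqrt_hel2_triangle.
  + by move=> u v Iu Iv; rewrite ler_pdivrMl//; exact: hel2_le_dist.
  + by rewrite /Hellinger Hellinger2_bool.
  + by apply: ler_wsqrtr; exact: hel2_le_Hellinger2.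
Qed.
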